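(* Let $k\geq 3$, $n=2^k$, $V=\mathbb{R}^n$, and let $d\leq 6$ be a positive integer. Then $$(V^{\otimes d})^{\mathcal{G}_k}=(V^{\otimes d})^{\mathcal{C}_k}=(V^{\otimes d})^{O(V)},$$ where each of these groups acts diagonally on $V^{\otimes d}$ (i.e. $g$ acts by $g^{\otimes d}$).
   Context: Let $V=\mathbb{R}^{n}$, $n=2^k$, with orthonormal basis $(e_u)_{u\in\mathbb{F}_2^k}$ indexed by $\mathbb{F}_2^k$. For $a,b\in\mathbb{F}_2^k$ define $X(a):e_u\mapsto e_{u+a}$ and $Y(b):e_u\mapsto(-1)^{b\cdot u}e_u$, and let $E=\langle -I, X(a),Y(b)\mid a,b\in\mathbb{F}_2^k\rangle$ (an extraspecial group $2^{1+2k}_+$). The Clifford group $\mathcal{C}_k$ is the normalizer of $E$ in $O(V)$. Identify $V$ with $(\mathbb{R}^2)^{\otimes k}$ via $e_u\mapsto e_{u_1}\otimes\cdots\otimes e_{u_k}$, and let $h=\frac{1}{\sqrt2}\begin{pmatrix}1&1\\1&-1\end{pmatrix}$, $H_2=h\otimes h\otimes I_2\otimes\cdots\otimes I_2$. The group $\mathcal{G}_k\le\mathcal{C}_k$ is the subgroup generated by: $-I$; the diagonal transformations $e_u\mapsto(-1)^{q(u)}e_u$ for all binary quadratic forms $q$ on $\mathbb{F}_2^k$; the permutation transformations $e_u\mapsto e_{\phi(u)}$ for $\phi\in AGL(k,2)$; and $H_2$. ($\mathcal{G}_k$ has index $2$ in $\mathcal{C}_k$ and is the automorphism group of the Barnes–Wall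 lattice for $n\neq 8$.) *)

(* Defs.v *)
From HB Require Import structures.
From mathcomp Require Import all_boot all_order all_algebra.
From mathcomp Require Import boolp classical_sets reals.

Set Implicit Arguments.
Unset Strict Implicit.
Unset Printing Implicit Defensive.

Import Order.TTheory GRing.Theory Num.Theory.
Local Open Scope classical_set_scope.
Local Open Scope ring_scope.

Section MatrixGroups.
Variables (R : comUnitRingType) (n : nat).

Definition orthogonal_group : set 'M[R]_n := [set g | g^T *m g = 1%:M].

Definition is_subgroup (G : set 'M[R]_n) : Prop :=
  [/\ G `<=` [set g | g \in unitmx],
      G 1%:M,
      forall g h, G g -> G h -> G (g *m h)
    & forall g, G g -> G (invmx g)].

(* The subgroup of GL_n(R) generated by S; meaningful for S included in
   GL_n(R), since [smallest] is the full set when no subgroup contains S. *)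
Definition generated (S : set 'M[R]_n) : set 'M[R]_n := smallest is_subgroup S.

Definition normalizer_in (G E : set 'M[R]_n) : set 'M[R]_n :=
  [set g | G g /\ [set g *m x *m invmx g | x in E] = E].

End MatrixGroups.

Arguments orthogonal_group R n : clear implicits.

(* An element t of (R^n)^{(x) d} is given by its coordinates: t j is the
   coefficient of e_(j 0) (x) ... (x) e_(j (d-1)).  The lemmas
   [tensor_basis_sum] and [tensor_act_pure] relate this, and the action below,
   to decomposable tensors. *)
Notation tensor R n d := {ffun {ffun 'I_d -> 'I_n} -> R^o}.

Section Tensors.
Variables (R : comUnitRingType) (n d : nat).
Implicit Types (g : 'M[R]_n) (t : tensor R n d).

Definition pure_tensor (v : 'I_d -> 'cV[R]_n) : tensor R n d :=
  [ffun j : {ffun 'I_d -> 'I_n} => \prod_l v l (j l) 0].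

Definition tensor_act g t : tensor R n d :=
  [ffun j : {ffun 'I_d -> 'I_n} => \sum_(i : {ffun 'I_d -> 'I_n}) (\prod_l g (j l) (i l)) * t i].

Definition invariant_tensors (G : set 'M[R]_n) : set (tensor R n d) :=
  [set t | forall g, G g -> tensor_act g t = t].

Lemma tensor_basis_sum t :
  t = \sum_(j : {ffun 'I_d -> 'I_n}) t j *: pure_tensor (fun l => delta_mx (j l) 0).
Proof.
apply/ffunP => j; rewrite sum_ffunE (bigD1 j) //= [X in _ + X]big1 ?addr0.
  rewrite !ffunE big1 ?[_ *: _]mulr1 // => l _.
  by rewrite mxE !eqxx.
move=> i neq_ij; rewrite !ffunE.
have /existsP[l neq_l] : [exists l, j l != i l].
  apply: contraR neq_ij => /existsPn eq_ij.
  by apply/eqP/ffunP => l; move/negPn/eqP: (eq_ij l).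
by rewrite (bigD1 l) //= mxE (negPf neq_l) mul0r scaler0.
Qed.

Lemma tensor_act_linear g : linear (tensor_act g).
Proof.
move=> a s t; apply/ffunP => j; rewrite !ffunE scaler_sumr -big_split /=.
apply: eq_bigr => i _; rewrite !ffunE mulrDr; congr (_ + _).
by rewrite [a *: s i]/(a * s i) mulrCA.
Qed.

Lemma tensor_act_pure g (v : 'I_d -> 'cV[R]_n) :
  tensor_act g (pure_tensor v) = pure_tensor (fun l => g *m v l).
Proof.
apply/ffunP => j; rewrite !ffunE.
under [RHS]eq_bigr => l _ do rewrite mxE.
rewrite bigA_distr_bigA; apply: eq_bigr => i _.
by rewrite ffunE big_split.
Qed.

End Tensors.

Notation cube k := 'rV['F_2]_k.

Lemma card_cube k : #|{: cube k}| = (2 ^ k)%N.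
Proof. by rewrite card_mx mul1n card_Fp. Qed.

Definition cube_index k (u : cube k) : 'I_(2 ^ k) :=
  cast_ord (card_cube k) (enum_rank u).

Definition index_cube k (i : 'I_(2 ^ k)) : cube k :=
  enum_val (cast_ord (esym (card_cube k)) i).

Lemma cube_indexK k : cancel (@cube_index k) (@index_cube k).
Proof. by move=> u; rewrite /index_cube cast_ordK enum_rankK. Qed.

Lemma index_cubeK k : cancel (@index_cube k) (@cube_index k).
Proof. by move=> i; rewrite /cube_index enum_valK cast_ordKV. Qed.

Section Clifford.
Variables (R : realType) (k : nat).

Definition evec (u : cube k) : 'cV[R]_(2 ^ k) := delta_mx (cube_index u) 0.

(* The linear map sending e_u to f u: f u is its column of index u. *)
Definition op_of_basis (f : cube k -> 'cV[R]_(2 ^ k)) : 'M[R]_(2 ^ k) :=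
  \matrix_(i, j) f (index_cube j) i 0.

Lemma op_of_basisE f u : op_of_basis f *m evec u = f u.
Proof.
by rewrite -colE; apply/colP => i; rewrite !mxE cube_indexK.
Qed.

Definition dotF2 (b u : cube k) : 'F_2 := (b *m u^T) 0 0.

Definition signF2 (x : 'F_2) : R := (-1) ^+ (x : nat).

Definition Xop (a : cube k) := op_of_basis (fun u => evec (u + a)).

Definition Yop (b : cube k) :=
  op_of_basis (fun u => signF2 (dotF2 b u) *: evec u).

Definition extraspecial_group : set 'M[R]_(2 ^ k) :=
  generated ([set - 1%:M] `|` range Xop `|` range Yop).

Definition clifford_group : set 'M[R]_(2 ^ k) :=
  normalizer_in (orthogonal_group R (2 ^ k)) extraspecial_group.

(* Homogeneous polynomials of degree 2 in the coordinates, as functions; A is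
   not assumed symmetric, since in characteristic 2 symmetric matrices do not
   give all quadratic forms. *)
Definition quadratic_form (q : cube k -> 'F_2) : Prop :=
  exists A : 'M['F_2]_k, forall u, q u = (u *m A *m u^T) 0 0.

Definition diag_op (q : cube k -> 'F_2) :=
  op_of_basis (fun u => signF2 (q u) *: evec u).

Definition affine_bijection (phi : cube k -> cube k) : Prop :=
  exists2 A : 'M['F_2]_k, A \in unitmx &
  exists b : cube k, forall u, phi u = u *m A + b.

Definition perm_op (phi : cube k -> cube k) :=
  op_of_basis (fun u => evec (phi u)).

(* A_0 (x) ... (x) A_(k-1) on (R^2)^{(x) k}, identified with V through
   e_u = e_(u_0) (x) ... (x) e_(u_(k-1)); 'F_2 is convertible to 'I_2. *)
Definition kronecker (A : 'I_k -> 'M[R]_2) : 'M[R]_(2 ^ k) :=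
  \matrix_(i, j) \prod_l A l (index_cube i 0 l) (index_cube j 0 l).

Definition hadamard : 'M[R]_2 :=
  (Num.sqrt 2)^-1 *: \matrix_(i, j) (if (i == 1) && (j == 1) then -1 else 1).

Definition H2 : 'M[R]_(2 ^ k) :=
  kronecker (fun l => if (l < 2)%N then hadamard else 1%:M).

Definition G_group : set 'M[R]_(2 ^ k) :=
  generated ([set - 1%:M]
    `|` [set diag_op q | q in quadratic_form]
    `|` [set perm_op phi | phi in affine_bijection]
    `|` [set H2]).

End Clifford.

Arguments clifford_group R k : clear implicits.
Arguments G_group R k : clear implicits.
Arguments invariant_tensors {R n} d G.

(* Main.v *)
Require Import Defs.
From HB Require Import structures.
From mathcomp Require Import all_boot all_order all_algebra.
From mathcomp Require Import boolp classical_sets reals.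

(* Invariance under the signs of quadratic forms and under [-I] forces the
   support of a [G]-invariant tensor to consist of tuples [(u_1, ..., u_d)] in
   which every point occurs an even number of times: the set of points with odd
   multiplicity is orthogonal to all polynomials of degree at most 2, hence
   empty or of size at least 8.  Such a tuple takes at most three values, so by
   3-transitivity of AGL(k, 2) its coordinate depends only on which of its
   entries coincide.  Subtracting a combination of the pairing tensors, which
   are [O(V)]-invariant, we may assume that the coordinates at tuples with all
   multiplicities equal to 2 vanish.  The remaining tuples have an entry [x] on
   a set [F] of at least four positions and one entry [z] on the other (at most
   two) positions.  If [F] is minimal with a nonzero such coordinate, invariance
   under [H2], read at a tuple splitting [F] into pairs, writes [0] as a
   positive multiple of that coordinate. *)

Set Implicit Arguments.
Unset Strict Implicit.
Unset Printing Implicit Defensive.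

Import Order.TTheory GRing.Theory Num.Theory.

(** * Perfect matchings of the tensor positions and their invariant tensors *)

Section Pairings.
Local Open Scope ring_scope.
Variable d : nat.

Definition pairing : pred {ffun 'I_d -> 'I_d} :=
  [pred p : {ffun 'I_d -> 'I_d} | [forall l, (p (p l) == l) && (p l != l)]].

Lemma pairingP (p : {ffun 'I_d -> 'I_d}) :
  reflect (involutive p /\ forall l, p l != l) (pairing p).
Proof.
apply: (iffP forallP) => [h|[h1 h2] l]; last by rewrite h1 eqxx h2.
by split=> l; case/andP: (h l) => // /eqP.
Qed.

Variables (R : comUnitRingType) (n : nat).

Definition pairing_tensor (p : {ffun 'I_d -> 'I_d}) : tensor R n d :=
  [ffun j : {ffun 'I_d -> 'I_n} => [forall l, j (p l) == j l]%:R].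

(** The condition [l < p l] selects one representative in each pair. *)
Lemma prod_pairing (p : {ffun 'I_d -> 'I_d}) (F : 'I_d -> R) : pairing p ->
  \prod_l F l = \prod_(l : 'I_d | (l < p l)%N) (F l * F (p l)).
Proof.
move=> /pairingP[pK p_neq].
rewrite (bigID [pred l : 'I_d | (l < p l)%N]) /= big_split /=; congr (_ * _).
rewrite (reindex_inj (inv_inj pK)) /=; apply: eq_bigl => l.
by rewrite pK -leqNgt leq_eqVlt; case: eqP => // /val_inj/eqP; rewrite eq_sym (negPf (p_neq l)).
Qed.

(* Contracting along each pair [{l, p l}] leaves the entry [(j l, j (p l))] of
   [g *m g^T]. *)
Lemma pairing_tensor_orthogonal (g : 'M[R]_n) (p : {ffun 'I_d -> 'I_d}) : (0 < d)%N ->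
  g *m g^T = 1%:M -> pairing p ->
  tensor_act g (pairing_tensor p) = pairing_tensor p.
Proof.
move=> d_gt0 ggT pp; have [pK p_neq] := pairingP _ pp.
apply/ffunP => j; rewrite !ffunE.
pose l0 := Ordinal d_gt0; pose A (l : 'I_d) := (l < p l)%N.
have AE l : A (p l) = ~~ A l.
  rewrite /A pK -leqNgt [RHS]leq_eqVlt; case: eqP => // /val_inj/eqP.
  by rewrite (negPf (p_neq l)).
(* Row orthonormality: the inner sum is the entry of [g *m g^T] at [(j l, j (p l))], a Kronecker
   delta. *)
have -> : [forall l, j (p l) == j l]%:R =
    \prod_(l | A l) (\sum_w g (j l) w * g (j (p l)) w) :> R.
  have E l : \sum_w g (j l) w * g (j (p l)) w = (j (p l) == j l)%:R.
    have := congr1 (fun M : 'M_n => M (j l) (j (p l))) ggT.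
    rewrite !mxE eq_sym => <-; apply: eq_bigr => w _; by rewrite mxE.
  under eq_bigr do rewrite E.
  case: forallP => [h|/forallP]; first by rewrite big1 // => l _; rewrite h.
  rewrite negb_forall => /existsP[l hl].
  have [l' Al' hl'] : exists2 l', A l' & j (p l') != j l'.
    case: (boolP (A l)) => [Al|nAl]; first by exists l.
    by exists (p l); rewrite ?AE // pK eq_sym.
  by rewrite (bigD1 l') //= (negPf hl') mul0r.
(* Distributing yields a sum over functions on the representatives, extended elsewhere by the
   default value [j l0]. *)
rewrite (big_distr_big (j l0)).
(* The indices surviving on the left are constant on pairs. Below, [h] copies values from the
   representatives to their partners, and [h'] restores the default value there. *)
under [LHS]eq_bigr do rewrite ffunE mulr_natr mulrb.
rewrite -big_mkcond /=.
pose h (f : {ffun 'I_d -> 'I_n}) : {ffun 'I_d -> 'I_n} :=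
  [ffun l => if A l then f l else f (p l)].
pose h' (i : {ffun 'I_d -> 'I_n}) : {ffun 'I_d -> 'I_n} :=
  [ffun l => if A l then i l else j l0].
rewrite (reindex_onto h h') => [|i /forallP hi]; last first.
  by apply/ffunP => l; rewrite !ffunE AE; case: (A l) => //; apply/eqP.
apply: eq_big => [f|f _]; last first.
  rewrite (prod_pairing _ pp); apply: eq_bigr => l Al.
  by rewrite !ffunE AE pK /A Al.
apply/andP/pffun_onP => [[_ /eqP <-]|[/fintype.subsetP hA _]].
  split=> //; apply/fintype.subsetP => l; rewrite inE ffunE.
  by rewrite [l \in _]/(A l); case: ifPn; rewrite ?eqxx.
split; first by apply/forallP => l; rewrite !ffunE AE pK; case: (A l).
apply/eqP/ffunP => l; rewrite !ffunE; case: (boolP (A l)) => [//|nAl].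
by apply/esym/eqP; apply: contraR nAl => fl; apply: (hA l); rewrite inE.
Qed.

End Pairings.

(** * Polynomials and affine maps over F_2 *)

Section BinaryCube.
Local Open Scope ring_scope.

Lemma F2_cases (x : 'F_2) : x = 0 \/ x = 1.
Proof.
case: x => [[|[|m]] hm]; [left|right|by []]; exact/val_inj.
Qed.

Lemma F2_mulrr (x : 'F_2) : x * x = x.
Proof. by case: (F2_cases x) => ->; rewrite ?mul0r ?mul1r. Qed.

Lemma F2_addrr (x : 'F_2) : x + x = 0.
Proof. by case: (F2_cases x) => ->; apply/val_inj. Qed.

Lemma F2_mulrn (x : 'F_2) n : x *+ n = x *+ odd n.
Proof.
elim: n => //= n IH; rewrite mulrS IH; case: (odd n) => /=.
  by rewrite mulr1n F2_addrr.
by rewrite addr0.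
Qed.

Lemma F2_neq_eq (x y : 'F_2) : x != y -> y = x + 1.
Proof.
by case: (F2_cases x) => ->; case: (F2_cases y) => ->; rewrite ?eqxx // => _;
  apply/val_inj.
Qed.

Variable k : nat.

Definition affine_form (c : 'cV['F_2]_k * 'F_2) (u : cube k) : 'F_2 :=
  (u *m c.1) 0 0 + c.2.

(* Reed-Muller duality: a nonempty set orthogonal to all polynomials of degree
   at most [r] has at least [2 ^ r.+1] points, since some hyperplane splits it
   into two nonempty halves. *)
Lemma odd_affine_product r (S : {set cube k}) : (0 < #|S| < 2 ^ r.+1)%N ->
  exists2 cs, size cs = r &
    \sum_(x in S) \prod_(c <- cs) affine_form c x = 1.
Proof.
elim: r S => [|r IH] S /andP[S_gt0 S_lt].
  have /eqP/cards1P[x ->] : #|S| = 1%N by case: #|S| S_gt0 S_lt => [|[]].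
  by exists [::]; rewrite // big_set1 big_nil.
have [S_lt'|S_ge] := ltnP #|S| (2 ^ r.+1).
  have [|cs size_cs cs1] := IH S; first by rewrite S_gt0.
  (* The constant form 1 pads the product to the required number of factors. *)
  exists ((0, 1) :: cs); first by rewrite /= size_cs.
  rewrite -[RHS]cs1; apply: eq_bigr => x _.
  rewrite big_cons; have -> : affine_form (0, 1) x = 1 by rewrite /affine_form mulmx0 mxE add0r.
  by rewrite mul1r.
have /card_gt1P[x [y [xS yS neq_xy]]] : (1 < #|S|)%N.
  by apply: leq_trans S_ge; rewrite (@leq_exp2l 2 1).
have /existsP[i neq_i] : [exists i, x 0 i != y 0 i].
  apply: contraR neq_xy => /existsPn h; apply/eqP/rowP => i.
  by move/negPn/eqP: (h i).
pose Sb (b : 'F_2) := [set u in S | u 0 i == b].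
have Sb_gt0 b : (0 < #|Sb b|)%N.
  apply/card_gt0P.
  have [|yb] := eqVneq (x 0 i) b; first by exists x; rewrite inE xS; apply/eqP.
  exists y; rewrite inE yS (F2_neq_eq neq_i) (F2_neq_eq yb) /=.
  by [].
(* The halves are disjoint, so they cannot both have [2 ^ r.+1] points. *)
have [b Sb_lt] : exists b, (#|Sb b| < 2 ^ r.+1)%N.
  have [h|h] := ltnP #|Sb 0| (2 ^ r.+1); first by exists 0.
  exists 1; rewrite -(ltn_add2l #|Sb 0|); apply: (@leq_trans (2 ^ r.+2)).
    apply: leq_ltn_trans S_lt; rewrite -cardsUI.
    have -> : Sb 0 :&: Sb 1 = finset.set0.
      by apply/setP => u; rewrite !inE; case: (F2_cases (u 0 i)) => ->; case: (u \in S).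
    rewrite cards0 addn0; apply: subset_leq_card; apply/fintype.subsetP => u.
    by rewrite !inE => /orP[] /andP[].
  by rewrite expnS mul2n -addnn leq_add2r.
have [|cs size_cs cs1] := IH (Sb b); first by rewrite Sb_gt0.
(* The new factor [u_i + b + 1] is the indicator function of the half [Sb b]. *)
exists ((delta_mx i 0, b + 1) :: cs); first by rewrite /= size_cs.
rewrite -[RHS]cs1.
rewrite [RHS](eq_bigl (fun u => (u \in S) && (u 0 i == b))); last by move=> u; rewrite inE.
rewrite [RHS]big_mkcondr; apply: eq_bigr => u uS; rewrite big_cons.
have -> : affine_form (delta_mx i 0, b + 1) u = u 0 i + (b + 1).
  by rewrite /affine_form -colE mxE.
have [->|/F2_neq_eq ->] := eqVneq (u 0 i) b.
  by rewrite addrA F2_addrr add0r mul1r.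
by rewrite -addrA F2_addrr addr0 F2_addrr mul0r.
Qed.

(** The points of odd multiplicity lie in the image of [u], so there are fewer than [2 ^ 3] of them;
    if there were any, a product of two affine forms would have sum 1 over them. *)
Lemma even_fibers d (u : {ffun 'I_d -> cube k}) : (d < 8)%N ->
    (forall c1 c2, \sum_l affine_form c1 (u l) * affine_form c2 (u l) = 0) ->
  forall x, ~~ odd #|[set l | u l == x]|.
Proof.
move=> d_lt u_orth x; pose S := [set x | odd #|[set l | u l == x]|].
suff /eqP S0 : S == finset.set0 by have /setP/(_ x) := S0; rewrite !inE => ->.
rewrite -cards_eq0 -leqn0 leqNgt; apply/negP => S_gt0.
have S_lt : (#|S| < 2 ^ 3)%N.
  apply: leq_ltn_trans d_lt; rewrite -[X in (_ <= X)%N]card_ord -cardsT.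
  apply: leq_trans (leq_imset_card u _); apply: subset_leq_card.
  apply/fintype.subsetP => y; rewrite inE => /odd_gt0 /card_gt0P[l].
  by rewrite inE => /eqP <-; apply: imset_f; rewrite inE.
have [|[|c1 [|c2 [|//]]] // _] := @odd_affine_product 2 S; first by rewrite S_gt0.
under eq_bigr do rewrite big_cons big_seq1.
move=> E; have := u_orth c1 c2; rewrite (partition_big u predT) //=.
suff -> : \sum_j \sum_(i | u i == j) affine_form c1 (u i) * affine_form c2 (u i) = 1.
  by move/eqP; rewrite oner_eq0.
(* Grouped by value, the sum counts each point with its multiplicity modulo 2, which leaves exactly
   the points of [S]. *)
rewrite -[RHS]E [RHS]big_mkcond; apply: eq_bigr => y _.
rewrite (eq_bigr (fun=> affine_form c1 y * affine_form c2 y)) => [|l /eqP -> //].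
rewrite sumr_const F2_mulrn -cardsE inE.
by case: odd.
Qed.

(** Since [x * x = x] in F_2, linear terms are quadratic forms given by diagonal matrices; only the
    constant term has to be removed. *)
Lemma quadratic_affine_product c1 c2 :
  quadratic_form (fun u => affine_form c1 u * affine_form c2 u - c1.2 * c2.2).
Proof.
exists (c1.1 *m c2.1^T + c2.2 *: diag_mx c1.1^T + c1.2 *: diag_mx c2.1^T) => u.
have diag (c : 'cV_k) : (u *m diag_mx c^T *m u^T) 0 0 = (u *m c) 0 0.
  rewrite mul_mx_diag !mxE; apply: eq_bigr => i _.
  by rewrite !mxE mulrAC F2_mulrr.
rewrite !mulmxDr !mulmxDl -!scalemxAr -!scalemxAl mulmxA -mulmxA -trmx_mul.
rewrite [in RHS]mxE [in RHS]mxE.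
rewrite [X in _ = _ + X]mxE diag [X in _ = _ + X + _]mxE diag [X in _ = X + _ + _]mxE.
rewrite big_ord1 [X in _ = _ * X + _ + _]mxE.
rewrite /affine_form mulrDl !mulrDr addrA addrK -!addrA; congr (_ + _).
by rewrite mulrC.
Qed.

(** The only scalars are 0 and 1, so a nontrivial relation would read [x = 0], [y = 0] or
    [x = y]. *)
Lemma row_free_pair (x y : cube k) : x != 0 -> y != 0 -> x != y ->
  row_free (col_mx x y).
Proof.
move=> x0 y0 xy; apply: inj_row_free => v.
rewrite -[v]hsubmxK mul_row_col.
rewrite [lsubmx v]mx11_scalar [rsubmx v]mx11_scalar !mul_scalar_mx.
set a := lsubmx _ _ _; set b := rsubmx _ _ _.
have row0 : row_mx (0%:M : 'M['F_2]_1) (0%:M : 'M['F_2]_1) = 0 by rewrite raddf0 row_mx0.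
case: (F2_cases a) => ->; case: (F2_cases b) => ->; rewrite ?scale0r ?scale1r ?add0r ?addr0 //.
- by move/eqP; rewrite (negPf y0).
- by move/eqP; rewrite (negPf x0).
move/eqP; rewrite addr_eq0 => /eqP E; case/eqP: xy; rewrite E.
by apply/rowP => i; rewrite mxE; apply/esym/eqP; rewrite -addr_eq0 F2_addrr.
Qed.

(** Both pairs of differences are linearly independent, so an invertible linear map sends one to the
    other; a translation then adjusts the base point. *)
Lemma affine_3transitive (x y z x' y' z' : cube k) :
    x != y -> x != z -> y != z -> x' != y' -> x' != z' -> y' != z' ->
  exists2 phi, affine_bijection phi & [/\ phi x = x', phi y = y' & phi z = z'].
Proof.
have free (a b c : cube k) : a != b -> a != c -> b != c ->
    row_free (col_mx (b - a) (c - a)).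
  move=> ab ac bc; apply: row_free_pair; rewrite ?subr_eq0 1?eq_sym //.
  by rewrite (inj_eq (addIr _)) eq_sym.
move=> xy xz yz x'y' x'z' y'z'.
have Af := free _ _ _ xy xz yz; have Bf := free _ _ _ x'y' x'z' y'z'.
set A := col_mx (y - x) _ in Af; set B := col_mx (y' - x') _ in Bf.
(* As [A] is row free, [pinvmx A] is a right inverse. The resulting map need not be invertible, and
   [complete_unitmx] replaces it by one that is and agrees with it on the rows of [A]. *)
have AB : A *m (pinvmx A *m B) = B by rewrite mulmxA mulmxVp ?mul1mx.
have [|P P_unit] := @complete_unitmx _ _ _ A (pinvmx A *m B).
  by rewrite AB; move: Af Bf; rewrite /row_free => /eqP -> /eqP.
rewrite AB /A /B mul_col_mx => /eq_col_mx[E1 E2].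
exists (fun u => u *m P + (x' - x *m P)); first by exists P => //; eexists.
split; first by rewrite addrCA subrr addr0.
- by rewrite addrCA -mulmxBl -E1 addrC subrK.
- by rewrite addrCA -mulmxBl -E2 addrC subrK.
Qed.

Hypothesis k_ge2 : (2 <= k)%N.

Lemma cube_fresh (x y : cube k) : exists2 z, z != x & z != y.
Proof.
have : (0 < #|~: [set x; y]|)%N.
  rewrite cardsCs finset.setCK card_cube subn_gt0 cards2.
  apply: (@leq_trans 4); first by case: (x == y).
  by rewrite (@leq_exp2l 2 2).
by case/card_gt0P => z; rewrite !inE negb_or => /andP[]; exists z.
Qed.

(** The values of [u] and the corresponding values of [v] are completed by fresh points to triples
    of distinct points, to which 3-transitivity applies. *)
Lemma affine_same_kernel d (u v : {ffun 'I_d -> cube k}) :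
    (#|u @: setT| <= 3)%N -> (forall l m, (u l == u m) = (v l == v m)) ->
  exists2 phi, affine_bijection phi & forall l, phi (u l) = v l.
Proof.
move=> u3 uv.
suff [x [y [z [x' [y' [z' [[xy xz yz] [x'y' x'z' y'z'] h]]]]]]] :
  exists x y z x' y' z' : cube k, [/\ [/\ x != y, x != z & y != z],
   [/\ x' != y', x' != z' & y' != z'] & forall l,
   [\/ u l = x /\ v l = x', u l = y /\ v l = y' | u l = z /\ v l = z']].
  have [phi aff [ex ey ez]] := affine_3transitive xy xz yz x'y' x'z' y'z'.
  by exists phi => // l; case: (h l) => [] [-> ->].
have dist (a b c : cube k) : b != a -> c != a -> c != b -> [/\ a != b, a != c & b != c].
  by rewrite eq_sym => -> /[1!eq_sym] -> /[1!eq_sym] ->.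
have same l m : u m == u l -> v m = v l by rewrite uv => /eqP.
case: (pickP (@predT 'I_d)) => [l0 _|no]; last first.
  have [y y0 _] := cube_fresh 0 0; have [z zx zy] := cube_fresh 0 y.
  exists 0, y, z, 0, y, z; split; try exact: dist.
  by move=> l; have := no l.
case: (pickP (fun l => u l != u l0)) => [l1 ul1|no1]; last first.
  have [y y0 _] := cube_fresh (u l0) 0; have [z zx zy] := cube_fresh (u l0) y.
  have [y' y'0 _] := cube_fresh (v l0) 0; have [z' z'x z'y] := cube_fresh (v l0) y'.
  exists (u l0), y, z, (v l0), y', z'; split; try exact: dist.
  move=> l; have /negbFE ul := no1 l.
  by constructor 1; split; [apply/eqP | apply: same].
case: (pickP (fun l => (u l != u l0) && (u l != u l1))) => [l2 /andP[u20 u21]|no2]; last first.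
  have [z zx zy] := cube_fresh (u l0) (u l1); have [z' z'x z'y] := cube_fresh (v l0) (v l1).
  exists (u l0), (u l1), z, (v l0), (v l1), z'; split; try apply: dist => //.
    by rewrite -uv.
  move=> l; have := no2 l; case: eqP => /= [e _|_ /negbFE e].
    by constructor 1; split=> //; apply: same; apply/eqP.
  by constructor 2; split; [apply/eqP | apply: same].
exists (u l0), (u l1), (u l2), (v l0), (v l1), (v l2).
split; try by apply: dist; rewrite -?uv.
move=> l.
(* The bound on the image rules out a fourth value. *)
have : u l \in [set u l0; u l1; u l2].
  have /eqP -> : [set u l0; u l1; u l2] == u @: setT; last by apply: imset_f; rewrite inE.
  rewrite eqEcard; apply/andP; split.
    by apply/fintype.subsetP => a; rewrite !inE => /orP[/orP[]|] /eqP ->;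
      apply: imset_f; rewrite inE.
  apply: leq_trans u3 _.
  by rewrite -finset.setUA cardsU1 cards2 !inE negb_or ![u l0 == _]eq_sym ul1 u20 eq_sym u21.
rewrite !inE => /orP[/orP[]|] e;
 [constructor 1|constructor 2|constructor 3]; by split; [apply/eqP | apply: same].
Qed.

End BinaryCube.

(** * Tensor coordinates indexed by tuples of points of the cube *)

Section CubeCoordinates.
Local Open Scope ring_scope.
Variables (R : realType) (k d : nat).
Implicit Types (g : 'M[R]_(2 ^ k)) (phi : cube k -> cube k) (t : tensor R (2 ^ k) d)
  (u v : {ffun 'I_d -> cube k}).

Definition cube_coord t u : R := t [ffun l => cube_index (u l)].

Lemma cube_coord_inj s t : cube_coord s =1 cube_coord t -> s = t.
Proof.
move=> st; apply/ffunP => j.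
have -> : j = [ffun l => cube_index ([ffun l => index_cube (j l)] l)].
  by apply/ffunP => l; rewrite !ffunE index_cubeK.
exact: st.
Qed.

Lemma cube_coord_act g t u : cube_coord (tensor_act g t) u =
  \sum_(v : {ffun 'I_d -> cube k})
    (\prod_l g (cube_index (u l)) (cube_index (v l))) * cube_coord t v.
Proof.
rewrite /cube_coord ffunE.
pose h v : {ffun 'I_d -> 'I_(2 ^ k)} := [ffun l => cube_index (v l)].
have h_bij : bijective h.
  exists (fun j : {ffun 'I_d -> 'I_(2 ^ k)} => [ffun l => index_cube (j l)]) => v.
    by apply/ffunP => l; rewrite !ffunE cube_indexK.
  by apply/ffunP => l; rewrite !ffunE index_cubeK.
rewrite (reindex h) /=; last exact: onW_bij.
by apply: eq_bigr => v _; congr (_ * _); apply: eq_bigr => l _; rewrite !ffunE.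
Qed.

(** A monomial matrix leaves a single term in the sum. This covers [- 1%:M], the diagonal and the
    permutation generators at once. *)
Lemma cube_coord_monomial g (s : cube k -> R) phi t u : injective phi ->
    (forall a b, g (cube_index a) (cube_index b) = s b * (a == phi b)%:R) ->
  cube_coord (tensor_act g t) [ffun l => phi (u l)] =
  (\prod_l s (u l)) * cube_coord t u.
Proof.
move=> phi_inj gE; rewrite cube_coord_act (bigD1 u) //= [X in _ + X]big1 ?addr0.
  by congr (_ * _); apply: eq_bigr => l _; rewrite gE ffunE eqxx mulr1.
move=> v neq_vu; have /existsP[l neq_l] : [exists l, u l != v l].
  apply: contraR neq_vu => /existsPn h; apply/eqP/ffunP => l.
  by move/negPn/eqP: (h l).
by rewrite (bigD1 l) //= gE ffunE (inj_eq phi_inj) (negPf neq_l) mulr0 !mul0r.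
Qed.

Lemma evecE (a b : cube k) : evec R b (cube_index a) 0 = (a == b)%:R.
Proof. by rewrite mxE (inj_eq (can_inj (@cube_indexK k))) andbT. Qed.

Lemma op_of_basis_entry (f : cube k -> 'cV[R]_(2 ^ k)) i b :
  op_of_basis f i (cube_index b) = f b i 0.
Proof. by rewrite mxE cube_indexK. Qed.

Lemma diag_op_entry (q : cube k -> 'F_2) a b :
  diag_op R q (cube_index a) (cube_index b) = signF2 R (q b) * (a == b)%:R.
Proof. by rewrite op_of_basis_entry mxE evecE. Qed.

Lemma perm_op_entry (phi : cube k -> cube k) a b :
  perm_op R phi (cube_index a) (cube_index b) = (a == phi b)%:R.
Proof. by rewrite op_of_basis_entry evecE. Qed.

Lemma affine_bijection_inj (phi : cube k -> cube k) :
  affine_bijection phi -> injective phi.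
Proof.
move=> [A A_unit [b phiE]] x y; rewrite !phiE => /addIr.
by move/(congr1 (mulmx^~ (invmx A))); rewrite !mulmxK.
Qed.

Lemma signF2_0 : signF2 R 0 = 1. Proof. by []. Qed.

Lemma signF2_1 : signF2 R 1 = -1. Proof. by rewrite /signF2 expr1. Qed.

Lemma signF2D (x y : 'F_2) : signF2 R (x + y) = signF2 R x * signF2 R y.
Proof.
by case: (F2_cases x) => ->; case: (F2_cases y) => ->;
  rewrite ?F2_addrr ?addr0 ?add0r ?signF2_0 ?signF2_1 ?mul1r ?mulr1 ?mulrNN ?mulr1.
Qed.

Lemma signF2_sum (I : finType) (q : I -> 'F_2) :
  signF2 R (\sum_i q i) = \prod_i signF2 R (q i).
Proof. by apply: (big_morph (signF2 R)) => //; exact: signF2D. Qed.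

Lemma hadamardE (x y : 'F_2) :
  hadamard R x y = (Num.sqrt 2)^-1 * signF2 R (x * y).
Proof.
rewrite !mxE; congr (_ * _).
by case: (F2_cases x) => ->; case: (F2_cases y) => ->;
  rewrite ?mulr0 ?mulr1 ?mul0r ?signF2_0 ?signF2_1.
Qed.

Lemma hadamard_neq0 (x y : 'F_2) : hadamard R x y != 0.
Proof.
rewrite hadamardE mulf_neq0 ?invr_eq0 ?sqrtr_eq0 -?ltNge ?ltr0n //.
by rewrite /signF2 signr_eq0.
Qed.

Lemma H2_entry (a b : cube k) : H2 R k (cube_index a) (cube_index b) =
  \prod_(l < k) (if (l < 2)%N then hadamard R else 1%:M) (a 0 l) (b 0 l).
Proof. by rewrite mxE !cube_indexK. Qed.

(** The Hadamard factors have no zero entry, so only the identity factors, at coordinates from 2 on,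
    can make the product vanish. *)
Lemma H2_neq0P (a b : cube k) :
  reflect (forall l : 'I_k, (2 <= l)%N -> a 0 l = b 0 l)
    (H2 R k (cube_index a) (cube_index b) != 0).
Proof.
rewrite H2_entry; apply: (iffP (prodf_neq0 _ _)) => [h l l2|h l _].
  have := h l isT; rewrite ltnNge l2 /= mxE.
  by case: (a 0 l =P b 0 l) => // _; rewrite eqxx.
by case: ltnP => [_|/h ->]; rewrite ?hadamard_neq0 // mxE eqxx oner_neq0.
Qed.

End CubeCoordinates.

(** * Constraints imposed by each generator on invariant tensors *)

Section InvariantSupport.
Local Open Scope ring_scope.
Variables (R : realType) (k d : nat) (t : tensor R (2 ^ k) d).
Hypothesis t_inv : invariant_tensors d (G_group R k) t.
Implicit Types u v : {ffun 'I_d -> cube k}.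

Let T u := cube_coord t u.

Lemma G_group_N1 : G_group R k (- 1%:M).
Proof. by apply: sub_gen_smallest; left; left; left. Qed.

Lemma G_group_diag q : quadratic_form q -> G_group R k (diag_op R q).
Proof. by move=> hq; apply: sub_gen_smallest; left; left; right; exists q. Qed.

Lemma G_group_perm phi : affine_bijection phi -> G_group R k (perm_op R phi).
Proof. by move=> hphi; apply: sub_gen_smallest; left; right; exists phi. Qed.

Lemma G_group_H2 : G_group R k (H2 R k).
Proof. by apply: sub_gen_smallest; right. Qed.

(** [- 1%:M] acts on tensors of degree [d] by the scalar [(-1) ^+ d]. *)
Lemma invariant_support_even_degree u : T u != 0 -> ~~ odd d.
Proof.
move=> Tu; have := @cube_coord_monomial R k d (- 1%:M) (fun=> -1) id t u (fun _ _ => id).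
rewrite t_inv; last exact: G_group_N1.
have -> : [ffun l => id (u l)] = u by apply/ffunP => l; rewrite ffunE.
move=> /(_ _) E; have {}E : T u = (-1) ^+ d * T u.
  rewrite [LHS]E ?prodr_const ?card_ord // => a b.
  by rewrite !mxE (inj_eq (can_inj (@cube_indexK k))) mulN1r.
move: E; rewrite -signr_odd; case: odd => //; rewrite expr1 mulN1r => /eqP.
by rewrite -addr_eq0 -mulr2n mulrn_eq0 /= (negPf Tu).
Qed.

Lemma invariant_support_quadratic u q :
  T u != 0 -> quadratic_form q -> \sum_l q (u l) = 0.
Proof.
move=> Tu hq; have := @cube_coord_monomial R k d _ _ id t u (fun _ _ => id) (diag_op_entry R q).
rewrite t_inv; last exact: G_group_diag.
have -> : [ffun l => id (u l)] = u by apply/ffunP => l; rewrite ffunE.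
rewrite -signF2_sum -/(T u); case: (F2_cases (\sum_l q (u l))) => -> //.
rewrite signF2_1 mulN1r => /eqP.
by rewrite -addr_eq0 -mulr2n mulrn_eq0 /= (negPf Tu).
Qed.

Lemma invariant_support_even_fibers u : (d <= 6)%N -> T u != 0 ->
  forall x, ~~ odd #|[set l | u l == x]|.
Proof.
move=> d6 Tu; apply: even_fibers => [|c1 c2]; first exact: leq_ltn_trans d6 _.
have := invariant_support_quadratic Tu (quadratic_affine_product c1 c2).
rewrite sumrB => /eqP; rewrite subr_eq0 => /eqP ->.
(* The constant term removed from the product of affine forms is summed [d] times, and [d] is
   even. *)
by rewrite sumr_const card_ord F2_mulrn (negPf (invariant_support_even_degree Tu)).
Qed.

(** The two tuples are related by an affine permutation, which moves coordinates without signs. *)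
Lemma invariant_same_kernel u v : (2 <= k)%N -> (#|u @: setT| <= 3)%N ->
  (forall l m, (u l == u m) = (v l == v m)) -> T u = T v.
Proof.
move=> k2 u3 uv; have [phi aff phi_uv] := affine_same_kernel k2 u3 uv.
have := @cube_coord_monomial R k d (perm_op R phi) (fun=> 1) phi t u (affine_bijection_inj aff).
rewrite t_inv; last exact: G_group_perm.
have -> : [ffun l => phi (u l)] = v by apply/ffunP => l; rewrite ffunE phi_uv.
rewrite /T => ->; first by rewrite big1 ?mul1r.
by move=> a b; rewrite perm_op_entry mul1r.
Qed.

Lemma invariant_H2_sum u :
  T u = \sum_(v : {ffun 'I_d -> cube k})
    (\prod_l H2 R k (cube_index (u l)) (cube_index (v l))) * T v.
Proof. by rewrite -cube_coord_act t_inv //; exact: G_group_H2. Qed.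

End InvariantSupport.

(** * The possible coincidence patterns of tuples with even fibres *)

Section PairTypes.
Local Open Scope ring_scope.
Variables (d k : nat).
Implicit Types (u v : {ffun 'I_d -> cube k}) (F : {set 'I_d}).

Definition pair_type u : bool := [forall l, #|[set m | u m == u l]| == 2%N].

Definition two_valued F (x z : cube k) : {ffun 'I_d -> cube k} :=
  [ffun l => if l \in F then x else z].

Lemma card_two_valued F x z : (#|two_valued F x z @: setT| <= 3)%N.
Proof.
have /subset_leq_card/leq_trans -> // : two_valued F x z @: setT \subset [set x; z].
  apply/fintype.subsetP => _ /imsetP[l _ ->]; rewrite !inE ffunE.
  by case: ifP; rewrite eqxx ?orbT.
by rewrite cards2; case: (x != z).
Qed.

(** Counting positions by value, with two positions for each value, gives twice the image size, at
    most 6. *)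
Lemma card_pair_type u : (d <= 6)%N -> pair_type u -> (#|u @: setT| <= 3)%N.
Proof.
move=> d6 /forallP hu; rewrite -(leq_pmul2r (isT : (0 < 2)%N)).
apply: leq_trans d6; rewrite -[X in (_ <= X)%N](card_ord d) -cardsT.
rewrite -sum_nat_const -sum1_card (partition_big u (mem (u @: setT))) /=; last first.
  by move=> l _; apply: imset_f; rewrite inE.
apply: leq_sum => _ /imsetP[l _ ->]; rewrite sum1dep_card.
apply: (leq_trans (eq_leq (esym (eqP (hu l))))).
by apply: subset_leq_card; apply/fintype.subsetP => m; rewrite !inE.
Qed.

Lemma pair_type_pairing u : pair_type u ->
  exists2 p, pairing p & forall l m, (u m == u l) = (m == l) || (m == p l).
Proof.
move=> /forallP hu.
(* [p l] is the other element of the fibre through [l]; as that fibre has two elements, the search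
   succeeds. *)
pose p := [ffun l => odflt l [pick m | (u m == u l) && (m != l)]].
have pP l : p l != l /\ [set m | u m == u l] = [set l; p l].
  have /cards2P[a [b [ab E]]] := hu l.
  have : l \in [set a; b] by rewrite -E inE.
  have memE m : (u m == u l) = (m \in [set a; b]) by rewrite -E inE.
  rewrite ffunE; case: pickP => [m /andP[]|no] /=; last first.
    move: (no a) (no b); rewrite !memE !inE !eqxx ?orbT /=.
    by move=> /negbFE/eqP al /negbFE/eqP bl; rewrite al bl eqxx in ab.
  rewrite memE E !inE => /orP[] /eqP -> neq_l /orP[] /eqP lE;
    rewrite lE ?eqxx // in neq_l *; split=> //.
  by rewrite finset.setUC.
have kerE l m : (u m == u l) = (m == l) || (m == p l).
  by have /setP/(_ m) := (pP l).2; rewrite !inE.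
exists p => //; apply/pairingP; split=> l; last exact: (pP l).1.
have : u l == u (p l) by rewrite eq_sym kerE eqxx orbT.
by rewrite kerE eq_sym (negPf (pP l).1) /= => /eqP.
Qed.

(** By parity, a fibre whose size is not 2 has at least four elements. At most two positions remain,
    and by parity again they are absent or form a single fibre. *)
Lemma even_not_pair_type u : (2 <= k)%N -> (d <= 6)%N ->
    (forall x, ~~ odd #|[set l | u l == x]|) -> ~~ pair_type u ->
  exists F x z,
    [/\ x != z, u = two_valued F x z, (4 <= #|F|)%N & ~~ odd #|F|].
Proof.
move=> k2 d6 u_even; rewrite negb_forall => /existsP[l0 l0_n2].
have fib_ge2 l : (2 <= #|[set m | u m == u l]|)%N.
  have : (0 < #|[set m | u m == u l]|)%N by apply/card_gt0P; exists l; rewrite inE.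
  by have := u_even (u l); case: #|_| => [|[]].
pose F := [set m | u m == u l0].
have F4 : (4 <= #|F|)%N.
  by move: l0_n2 (fib_ge2 l0) (u_even (u l0)); rewrite -/F; case: #|F| => [|[|[|[]]]].
have FC2 : (#|~: F| <= 2)%N.
  rewrite -(leq_add2l 4); apply: leq_trans d6; rewrite -[X in (_ <= X)%N](card_ord d).
  by rewrite -(cardsC F) leq_add2r.
exists F, (u l0).
case: (pickP (fun l => l \notin F)) => [l1 l1F|no]; last first.
  (* Here [F] contains every position and [u] is constant; any other point serves as [z]. *)
  have [z z_neq _] := cube_fresh k2 (u l0) 0.
  exists z; split=> //; first by rewrite eq_sym.
    apply/ffunP => l; rewrite ffunE; have /negbFE -> := no l.
    by have := no l; rewrite inE => /negbFE/eqP.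
  exact: u_even.
exists (u l1); split=> //; first by move: l1F; rewrite inE eq_sym.
  apply/ffunP => l; rewrite ffunE; case: ifPn; rewrite inE; first by move/eqP.
  move=> lF.
  have /eqP fibE : [set m | u m == u l1] == ~: F.
    rewrite eqEcard (leq_trans FC2 (fib_ge2 l1)) andbT.
    apply/fintype.subsetP => m; rewrite !inE => /eqP ->.
    by move: l1F; rewrite inE.
  have /setP/(_ l) := fibE.
  by rewrite !inE lF => /eqP.
exact: u_even.
Qed.

End PairTypes.

(** * Vanishing of invariant tensors that are zero at pair types *)

Section Vanishing.
Local Open Scope ring_scope.
Variables (R : realType) (k d : nat) (t : tensor R (2 ^ k) d).
Hypotheses (k_ge3 : (3 <= k)%N) (d_le6 : (d <= 6)%N).
Hypothesis t_inv : invariant_tensors d (G_group R k) t.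
Hypothesis t_pair0 : forall u, pair_type u -> cube_coord t u = 0.
Implicit Types (u v : {ffun 'I_d -> cube k}) (F : {set 'I_d}).

Let T u := cube_coord t u.
Let k_ge2 : (2 <= k)%N := ltnW k_ge3.
Let c2 : 'I_k := Ordinal k_ge3.

(* The first two coordinates of [plane_point m] are the last two binary digits
   of [m]; [H2] preserves the span of these four basis vectors, as well as that
   of their translates by [z0]. *)
Let plane_point (m : nat) : cube k :=
  \row_l (if l == 0%N :> nat then (odd m)%:R
          else if l == 1%N :> nat then (odd m./2)%:R else 0).

Let z0 : cube k := \row_l (l == c2)%:R.

Lemma plane_point_inj : {in gtn 4 &, injective plane_point}.
Proof.
have b_inj (b b' : bool) : b%:R = b'%:R :> 'F_2 -> b = b' by case: b; case: b'.
move=> m m' m4 m'4 /rowP E.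
have := E (Ordinal (ltn_trans (isT : (0 < 2)%N) k_ge3)); rewrite !mxE /= => /b_inj E0.
have := E (Ordinal k_ge2); rewrite !mxE /= => /b_inj E1.
move: m4 m'4 E0 E1; rewrite !inE {E}.
by case: m => [|[|[|[|//]]]]; case: m' => [|[|[|[|//]]]].
Qed.

Lemma plane_point_c2 m : plane_point m 0 c2 = 0.
Proof. by rewrite mxE. Qed.

Lemma plane_point_ge2 m (l : 'I_k) : (2 <= l)%N -> plane_point m 0 l = 0.
Proof. by rewrite mxE; case: (nat_of_ord l) => [|[]]. Qed.

Lemma z0_c2 : z0 0 c2 = 1.
Proof. by rewrite mxE eqxx. Qed.

(** The elements of [F], in the order of [enum F], are grouped two by two, each group being sent to
    its own point of the plane. The third coordinate, which [H2] preserves, tells [F] from its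
    complement. *)
Let split_pairs F : {ffun 'I_d -> cube k} :=
  [ffun l => if l \in F then plane_point (index l (enum F))./2 else z0].

Lemma split_pairs_c2 F l : split_pairs F l 0 c2 = (l \notin F)%:R.
Proof. by rewrite ffunE; case: ifP => _; rewrite ?plane_point_c2 ?z0_c2. Qed.

Lemma index_map_iota (S : eqType) (s : seq S) : uniq s ->
  [seq index x s | x <- s] = iota 0 (size s).
Proof.
case: s => // x s us; apply: (@eq_from_nth _ 0%N); first by rewrite size_map size_iota.
move=> i; rewrite size_map => i_lt.
by rewrite (nth_map x) // index_uniq // nth_iota.
Qed.

Lemma split_pairs_pair_type F : (4 <= #|F|)%N -> ~~ odd #|F| -> ~~ odd d ->
  pair_type (split_pairs F).
Proof.
move=> F4 Feven d_even; apply/forallP => l.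
have F6 : (#|F| <= 6)%N by apply: leq_trans d_le6; rewrite -[leqRHS](card_ord d) max_card.
have [lF|lF] := boolP (l \in F); last first.
  have -> : [set m | split_pairs F m == split_pairs F l] = ~: F.
    apply/setP => m; rewrite !inE; have [mF|mF] := boolP (m \in F).
      apply/negbTE/eqP => /(congr1 (fun u : cube k => u 0 c2)).
      by rewrite !split_pairs_c2 mF lF.
    by rewrite !ffunE (negPf mF) (negPf lF) eqxx.
  (* The complement is nonempty, even and of size at most 2, so it is itself a pair. *)
  have FC0 : (0 < #|~: F|)%N by apply/card_gt0P; exists l; rewrite inE.
  have : ~~ odd (#|F| + #|~: F|) by rewrite cardsC card_ord.
  rewrite oddD (negPf Feven) /= => FCeven.
  have FC2 : (#|~: F| <= 2)%N.
    rewrite -(leq_add2l 4); apply: (@leq_trans (#|F| + #|~: F|)).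
      by rewrite leq_add2r.
    by rewrite cardsC card_ord.
  by move: FC0 FCeven FC2; case: #|_| => [|[|[]]].
set i := (index l (enum F))./2.
have idx_lt m : m \in F -> (index m (enum F) < #|F|)%N.
  by move=> mF; rewrite cardE index_mem mem_enum.
have half_lt m : m \in F -> ((index m (enum F))./2 < #|F|./2)%N.
  by move=> /idx_lt h;
    rewrite ltn_half_double -[X in (_ < X)%N](odd_double_half #|F|) (negPf Feven) add0n in h *.
have half_lt4 m : m \in F -> ((index m (enum F))./2 < 4)%N.
  by move=> /half_lt h; apply: leq_trans h _; apply: (leq_trans (half_leq F6)).
have -> : [set m | split_pairs F m == split_pairs F l] =
    [set m in F | (index m (enum F))./2 == i].
  apply/setP => m; rewrite !inE; have [mF|mF] /= := boolP (m \in F).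
    rewrite !ffunE mF lF; apply/eqP/eqP => [|-> //].
    by apply: plane_point_inj; rewrite inE ?half_lt4.
  apply/negbTE/eqP => /(congr1 (fun u : cube k => u 0 c2)).
  by rewrite !split_pairs_c2 (negPf mF) lF.
(* Replacing positions by their ranks leaves a count of integers, checked below for [#|F|] equal to
   4 or 6. *)
have -> : #|[set m in F | (index m (enum F))./2 == i]| =
    count (fun n => n./2 == i) (iota 0 #|F|).
  rewrite [X in iota 0 X]cardE -index_map_iota ?enum_uniq // count_map -size_filter.
  rewrite cardE; apply/perm_size/uniq_perm.
  - exact: enum_uniq.
  - exact/filter_uniq/enum_uniq.
  by move=> m; rewrite mem_enum inE mem_filter mem_enum /= andbC.
have := half_lt l lF; rewrite -/i; move: F4 Feven F6.
case: #|F| => [|[|[|[|[|[|[|[]]]]]]]] // _ _ _; by case: i => [|[|[]]].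
Qed.

Lemma invariant_two_valued F x z x' z' : x != z -> x' != z' ->
  T (two_valued F x z) = T (two_valued F x' z').
Proof.
move=> xz x'z'; apply: (invariant_same_kernel t_inv k_ge2); first exact: card_two_valued.
move=> l m; rewrite !ffunE.
by do 2!case: ifP => _; rewrite ?eqxx ?(negPf xz) ?(negPf x'z') //
  eq_sym ?(negPf xz) eq_sym ?(negPf x'z').
Qed.

Let neq_0z0 : 0 != z0.
Proof.
apply/eqP => /(congr1 (fun u : cube k => u 0 c2)); rewrite z0_c2 mxE.
by move/eqP; rewrite eq_sym oner_eq0.
Qed.

(* Averaging over [H2]: the coordinate of [t] at [split_pairs F], which is [0],
   is a nonnegative combination, not identically zero, of coordinates that are
   equal to the one at [two_valued F 0 z0]. *)
Lemma invariant_two_valued_eq0 F : (4 <= #|F|)%N -> ~~ odd #|F| ->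
  T (two_valued F 0 z0) = 0.
Proof.
(* Strong induction on the size of [F]. *)
have [n] := ubnP #|F|; elim: n => // n IH in F *; rewrite ltnS => Fn F4 Feven.
apply/eqP; apply/negPn/negP => TF; have d_even := invariant_support_even_degree t_inv TF.
have pt := split_pairs_pair_type F4 Feven d_even.
set j := split_pairs F in pt.
pose coef v := \prod_l H2 R k (cube_index (j l)) (cube_index (v l)).
pose W v := [exists x, exists z, v == two_valued F x z].
(* A tuple with nonzero coefficient has the same third coordinates as [j], hence separates [F] from
   its complement. *)
have coef_c2 v l : coef v != 0 -> v l 0 c2 = (l \notin F)%:R.
  by move=> /prodf_neq0/(_ l isT)/H2_neq0P/(_ c2 isT) <-; rewrite split_pairs_c2.
have b_neq : (0 : 'F_2) != 1 by [].
(* The factor at [l] depends only on the point [j l], and each point in the image of [j] is taken at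
   exactly two positions: the product is one of squares. *)
have coef_ge0 v : W v -> 0 <= coef v.
  move=> /existsP[x /existsP[z /eqP ->]].
  pose e y := H2 R k (cube_index y) (cube_index (if y 0 c2 == 0 then x else z)).
  have -> : coef (two_valued F x z) = \prod_l e (j l).
    apply: eq_bigr => l _; rewrite /e split_pairs_c2 [two_valued F x z l]ffunE.
    by case: (l \in F).
  rewrite (partition_big j predT) //=; apply: prodr_ge0 => y _.
  rewrite (eq_bigr (fun=> e y)) => [|l /eqP -> //].
  rewrite prodr_const -cardsE.
  have [->|[l]] := set_0Vmem [set l | j l == y]; first by rewrite cards0 expr0.
  rewrite inE => /eqP <-; rewrite (eqP (forallP pt l)).
  exact: sqr_ge0.
(* If the term is nonzero, [v] is not of pair type, so it is two-valued with a large fibre [F'].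
   Either [F' = F], and [v] has the kernel of [two_valued F 0 z0], or [F'] is a proper subset,
   excluded by induction. *)
have main v : coef v * T v = (if W v then coef v else 0) * T (two_valued F 0 z0).
  have [->|cv] := eqVneq (coef v) 0; first by rewrite if_same !mul0r.
  case: ifPn => [/existsP[x /existsP[z /eqP vE]]|nW].
    congr (_ * _); apply: (invariant_same_kernel t_inv k_ge2).
      by rewrite vE card_two_valued.
    have sep l m : l \in F -> m \notin F -> v l != v m.
      move=> lF mF; apply/eqP => /(congr1 (fun u : cube k => u 0 c2)).
      by rewrite !coef_c2 // lF mF.
    move=> l m; have [lF|lF] := boolP (l \in F); have [mF|mF] := boolP (m \in F).
    - by rewrite vE !ffunE lF mF !eqxx.
    - by rewrite (negPf (sep _ _ lF mF)) !ffunE lF (negPf mF) (negPf neq_0z0).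
    - by rewrite eq_sym (negPf (sep _ _ mF lF)) !ffunE mF (negPf lF) eq_sym (negPf neq_0z0).
    - by rewrite vE !ffunE (negPf lF) (negPf mF) !eqxx.
  rewrite mul0r; apply/eqP; rewrite mulf_eq0 (negPf cv) /=.
  apply/negPn/negP => Tv.
  have [/t_pair0 Tv0|npt] := boolP (pair_type v); first by rewrite /T Tv0 eqxx in Tv.
  have [F' [x [z [xz vE F'4 F'even]]]] :=
    even_not_pair_type k_ge2 d_le6 (invariant_support_even_fibers t_inv d_le6 Tv) npt.
  have sub : F' \subset F.
    apply/fintype.subsetP => l lF'; apply/negPn/negP => lF.
    (* The third coordinate of [v] is constant on [F'], so one position outside [F] puts all of [F']
       outside; then [4 + 4] positions would be needed. *)
    have : F' \subset ~: F.
      apply/fintype.subsetP => m mF'; rewrite inE; apply/negP => mF.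
      have := coef_c2 v m cv; rewrite mF /= vE ffunE mF'.
      have := coef_c2 v l cv; rewrite lF /= vE ffunE lF' => -> /eqP.
      by rewrite oner_eq0.
    move/subset_leq_card => /(leq_trans F'4); rewrite -(leq_add2l #|F|) cardsC card_ord.
    move=> h; have := leq_trans h d_le6; rewrite leqNgt; apply/negP/negPn.
    by apply: (@leq_trans (4 + 4)); rewrite ?leq_add2r.
  have [FE|F'F] := eqVneq F' F.
    by case/negP: nW; apply/existsP; exists x; apply/existsP; exists z; rewrite vE FE.
  case/eqP: Tv; rewrite vE (invariant_two_valued F' xz neq_0z0).
  apply: IH => //; apply: leq_trans Fn; apply: proper_card.
  by rewrite finset.properEneq F'F.
have v0W : W (two_valued F 0 z0) by apply/existsP; exists 0; apply/existsP; exists z0.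
(* This tuple differs from [j] in the first two coordinates at most. *)
have v0_neq0 : coef (two_valued F 0 z0) != 0.
  apply/prodf_neq0 => l _; apply/H2_neq0P => i i2; rewrite !ffunE.
  by case: ifP => // _; rewrite plane_point_ge2 ?mxE.
have := invariant_H2_sum t_inv j; rewrite [LHS]t_pair0 // (eq_bigr _ (fun v _ => main v)).
rewrite -mulr_suml => /esym/eqP; rewrite mulf_eq0 (negPf TF) orbF; apply/negP.
rewrite gt_eqF // (bigD1 (two_valued F 0 z0)) //= v0W.
apply: ltr_wpDr; last by rewrite lt_def v0_neq0 coef_ge0.
by apply: sumr_ge0 => v _; case: ifP => // /coef_ge0.
Qed.

Lemma invariant_eq0 : t = 0.
Proof.
apply: cube_coord_inj => u; rewrite [RHS]ffunE; apply/eqP/negPn/negP => Tu.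
have [/t_pair0 Tu0|npt] := boolP (pair_type u); first by rewrite Tu0 eqxx in Tu.
have [F [x [z [xz uE F4 Feven]]]] :=
  even_not_pair_type k_ge2 d_le6 (invariant_support_even_fibers t_inv d_le6 Tu) npt.
case/eqP: Tu; rewrite uE [LHS](invariant_two_valued F xz neq_0z0).
exact: invariant_two_valued_eq0.
Qed.

End Vanishing.

(** * Generated subgroups and normalizers in matrix groups *)

Section SubgroupsOfGL.
Local Open Scope classical_set_scope.
Local Open Scope ring_scope.
Variables (R : comUnitRingType) (n : nat).
Implicit Types (S E : set 'M[R]_n) (g h x : 'M[R]_n).

Lemma unitmx_subgroup : is_subgroup [set g : 'M[R]_n | g \in unitmx].
Proof.
split=> [//||g h /= gu hu|g /=]; first exact: unitmx1.
- by rewrite unitmx_mul gu.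
- by rewrite unitmx_inv.
Qed.

(** Invertibility of the generators provides a subgroup containing [S], so the intersection is over
    a nonempty family. *)
Lemma generated_subgroup S : S `<=` [set g | g \in unitmx] ->
  is_subgroup (generated S).
Proof.
move=> Su; split.
- by apply: smallest_sub => //; exact: unitmx_subgroup.
- by move=> G [[_ G1 _ _] _].
- by move=> g h Eg Eh G [sG SG]; have [_ _ GM _] := sG; apply: GM; [apply: Eg|apply: Eh].
- by move=> g Eg G [sG SG]; have [_ _ _ GV] := sG; apply: GV; apply: Eg.
Qed.

Lemma orthogonal_unitmx g : orthogonal_group R n g -> g \in unitmx.
Proof. by move=> /mulmx1_unit[]. Qed.

Lemma orthogonal_invmx g : orthogonal_group R n g -> invmx g = g^T.
Proof.
move=> og; have gu := orthogonal_unitmx og.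
by rewrite -[LHS]mul1mx -og mulmxK.
Qed.

Lemma orthogonal_subgroup : is_subgroup (orthogonal_group R n).
Proof.
split=> [g /orthogonal_unitmx //||g h /= og oh|g og] /=.
- by rewrite /orthogonal_group /= trmx1 mulmx1.
- by rewrite /orthogonal_group /= trmx_mul mulmxA -[_ *m g^T *m g]mulmxA og mulmx1.
- by rewrite orthogonal_invmx // /orthogonal_group /= trmxK; apply: mulmx1C.
Qed.

Lemma invmxM g h : g \in unitmx -> h \in unitmx ->
  invmx (g *m h) = invmx h *m invmx g.
Proof.
move=> gu hu; have ghu : g *m h \in unitmx by rewrite unitmx_mul gu.
apply: (can_inj (mulKmx ghu)); rewrite mulmxV // mulmxA -[_ *m invmx h]mulmxA.
by rewrite mulmxV // mulmx1 mulmxV.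
Qed.

Lemma normalizer_subgroup E :
  is_subgroup (normalizer_in (orthogonal_group R n) E).
Proof.
have [_ O1 OM OV] := orthogonal_subgroup.
split=> [g [/orthogonal_unitmx] //||g h [og nE] [oh nE']|g [og nE]].
- split=> //; rewrite invmx1 -[RHS]image_id; apply: eq_imagel => x _.
  by rewrite mul1mx mulmx1.
- have gu := orthogonal_unitmx og; have hu := orthogonal_unitmx oh.
  split; first exact: OM; rewrite -[RHS]nE -[in RHS]nE' image_comp.
  by apply: eq_imagel => x _; rewrite /= invmxM // !mulmxA.
- have gu := orthogonal_unitmx og; split; first exact: OV.
  rewrite -[in LHS]nE image_comp -[RHS]image_id; apply: eq_imagel => x _ /=.
  by rewrite invmxK !mulmxA mulVmx // mul1mx mulmxKV.
Qed.

(** The invertible elements whose conjugate by [g] lies in [generated S] form a subgroup containing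
    [S]. *)
Lemma generated_conj S g : g \in unitmx -> S `<=` [set g | g \in unitmx] ->
    (forall x, S x -> generated S (g *m x *m invmx g)) ->
  forall x, generated S x -> generated S (g *m x *m invmx g).
Proof.
move=> gu Su gS x Ex.
have [Eu E1 EM EV] := generated_subgroup Su.
suff : [set x | x \in unitmx /\ generated S (g *m x *m invmx g)] x by case.
apply: Ex; split; last by move=> y Sy; split; [exact: Su|exact: gS].
split=> [y [] //||y z [yu Ey] [zu Ez]|y [yu Ey]] /=.
- by rewrite unitmx1 mulmx1 mulmxV.
- split; first by rewrite unitmx_mul yu.
  have -> : g *m (y *m z) *m invmx g = (g *m y *m invmx g) *m (g *m z *m invmx g).
    by rewrite !mulmxA mulmxKV.
  exact: EM.
- split; first by rewrite unitmx_inv.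
  have -> : g *m invmx y *m invmx g = invmx (g *m y *m invmx g).
    by rewrite !invmxM ?unitmx_mul ?unitmx_inv ?gu ?yu // invmxK mulmxA.
  exact: EV.
Qed.

(** Conjugation by [g] gives one inclusion, and conjugation by its inverse [h] the other.
    Commutation relations replace conjugates so that no inverse has to be computed. *)
Lemma normalizer_generated S g h : S `<=` [set g | g \in unitmx] ->
    orthogonal_group R n g -> g *m h = 1%:M ->
    (forall x, S x -> exists2 y, generated S y & g *m x = y *m g) ->
    (forall x, S x -> exists2 y, generated S y & h *m x = y *m h) ->
  normalizer_in (orthogonal_group R n) (generated S) g.
Proof.
move=> Su og gh gS hS; have gu := orthogonal_unitmx og.
have hg := mulmx1C gh; have [_ hu] := mulmx1_unit gh.
have hE : h = invmx g by rewrite -[LHS]mul1mx -(mulVmx gu) -mulmxA gh mulmx1.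
have conjS a : a \in unitmx ->
    (forall x, S x -> exists2 y, generated S y & a *m x = y *m a) ->
    forall x, generated S x -> generated S (a *m x *m invmx a).
  move=> au aS; apply: generated_conj => // x /aS[y Ey ->].
  by rewrite mulmxK.
split=> //; apply/seteqP; split=> [_ [x Ex <-]|x Ex]; first exact: conjS.
exists (h *m x *m invmx h); first exact: conjS.
by rewrite hE invmxK !mulmxA mulmxV // mul1mx mulmxK.
Qed.

End SubgroupsOfGL.

(** * The generators of [G_group] lie in the Clifford group *)

Section CliffordGenerators.
Local Open Scope classical_set_scope.
Local Open Scope ring_scope.
Variables (R : realType) (k : nat).
Implicit Types (A B : 'M[R]_(2 ^ k)) (u w : cube k) (q : cube k -> 'F_2).
Implicit Types phi psi : cube k -> cube k.
Local Notation ci := (@cube_index k).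

Lemma cube_mxP A B : (forall w u, A (ci w) (ci u) = B (ci w) (ci u)) -> A = B.
Proof.
by move=> h; apply/matrixP => i j; rewrite -(index_cubeK i) -(index_cubeK j).
Qed.

Lemma cube_mulmx A B w u :
  (A *m B) (ci w) (ci u) = \sum_v A (ci w) (ci v) * B (ci v) (ci u).
Proof.
rewrite mxE (reindex ci) //=; apply: onW_bij.
by exists (@index_cube k); [exact: cube_indexK|exact: index_cubeK].
Qed.

Lemma mul_diag_op q A w u :
  (diag_op R q *m A) (ci w) (ci u) = signF2 R (q w) * A (ci w) (ci u).
Proof.
rewrite cube_mulmx (bigD1 w) //= big1 ?addr0 => [|v /negPf vw].
  by rewrite diag_op_entry eqxx mulr1.
by rewrite diag_op_entry eq_sym vw mulr0 mul0r.
Qed.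

Lemma mulmx_diag_op q A w u :
  (A *m diag_op R q) (ci w) (ci u) = A (ci w) (ci u) * signF2 R (q u).
Proof.
rewrite cube_mulmx (bigD1 u) //= big1 ?addr0 => [|v /negPf vu].
  by rewrite diag_op_entry eqxx mulr1.
by rewrite diag_op_entry vu !mulr0.
Qed.

Lemma mulmx_perm_op phi A w u :
  (A *m perm_op R phi) (ci w) (ci u) = A (ci w) (ci (phi u)).
Proof.
rewrite cube_mulmx (bigD1 (phi u)) //= big1 ?addr0 => [|v /negPf vu].
  by rewrite perm_op_entry eqxx mulr1.
by rewrite perm_op_entry vu mulr0.
Qed.

Lemma XopE (a : cube k) : Xop R a = perm_op R (fun u => u + a).
Proof. by []. Qed.

Lemma YopE (b : cube k) : Yop R b = diag_op R (dotF2 b).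
Proof. by []. Qed.

Lemma mul_Xop a A w u : (Xop R a *m A) (ci w) (ci u) = A (ci (w - a)) (ci u).
Proof.
rewrite XopE cube_mulmx (bigD1 (w - a)) //= big1 ?addr0 => [|v neq_v].
  by rewrite perm_op_entry subrK eqxx mul1r.
rewrite perm_op_entry; case: eqP => [wE|_]; last by rewrite mul0r.
by rewrite wE addrK eqxx in neq_v.
Qed.

Lemma cube_1mx w u : (1%:M : 'M[R]_(2 ^ k)) (ci w) (ci u) = (w == u)%:R.
Proof. by rewrite mxE (inj_eq (can_inj (@cube_indexK k))). Qed.

Lemma signF2_sqr (x : 'F_2) : signF2 R x * signF2 R x = 1.
Proof. by rewrite -signF2D F2_addrr signF2_0. Qed.

Lemma diag_op_sqr q : diag_op R q *m diag_op R q = 1%:M.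
Proof.
apply: cube_mxP => w u; rewrite mul_diag_op diag_op_entry cube_1mx.
by case: eqP => [->|_]; rewrite ?mulr0 // mulr1 signF2_sqr.
Qed.

Lemma diag_op_orthogonal q : orthogonal_group R _ (diag_op R q).
Proof.
rewrite /orthogonal_group /= -[RHS](diag_op_sqr q); congr (_ *m _).
apply: cube_mxP => w u; rewrite mxE !diag_op_entry eq_sym.
by case: eqP => [->|_]; rewrite ?mulr0.
Qed.

Lemma perm_op_mul phi psi : cancel psi phi ->
  perm_op R phi *m perm_op R psi = 1%:M :> 'M[R]_(2 ^ k).
Proof.
move=> K; apply: cube_mxP => w u.
by rewrite mulmx_perm_op perm_op_entry cube_1mx K.
Qed.

Lemma affine_bijection_inv (phi : cube k -> cube k) : affine_bijection phi ->
  exists psi, [/\ affine_bijection psi, cancel psi phi & cancel phi psi].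
Proof.
move=> [A Au [b phiE]]; exists (fun u => (u - b) *m invmx A); split.
- exists (invmx A); first by rewrite unitmx_inv.
  by exists (- (b *m invmx A)) => u; rewrite mulmxBl.
- by move=> u; rewrite phiE mulmxKV // subrK.
- by move=> u; rewrite phiE addrK mulmxK.
Qed.

Lemma perm_op_orthogonal phi :
  affine_bijection phi -> orthogonal_group R _ (perm_op R phi).
Proof.
move=> aff; have phi_inj := affine_bijection_inj aff.
apply: cube_mxP => w u; rewrite mulmx_perm_op mxE perm_op_entry cube_1mx.
by rewrite (inj_eq phi_inj) eq_sym.
Qed.

Lemma hadamard_sym (x y : 'F_2) : hadamard R x y = hadamard R y x.
Proof. by rewrite !hadamardE [y * x]mulrC. Qed.

Lemma hadamard_sqr : hadamard R *m hadamard R = 1%:M.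
Proof.
apply/matrixP => x y; rewrite !mxE big_ord_recl big_ord1.
rewrite !hadamardE -!mulrA ![signF2 R _ * (_ * _)]mulrCA -!mulrDr mulrA -!signF2D.
rewrite -invfM -expr2 sqr_sqrtr ?ler0n //.
have -> : lift ord0 ord0 = 1 :> 'F_2 by apply/val_inj.
have -> : ord0 = 0 :> 'F_2 by apply/val_inj.
rewrite !mulr0 !mul0r !mulr1 !mul1r addr0 signF2_0.
have [->|/F2_neq_eq ->] := eqVneq (x : 'F_2) y.
  by rewrite F2_addrr signF2_0 mulVf // pnatr_eq0.
by rewrite addrA F2_addrr add0r signF2_1 subrr mulr0.
Qed.

Lemma H2_sqr : H2 R k *m H2 R k = 1%:M.
Proof.
pose M (l : 'I_k) : 'M[R]_2 := if (l < 2)%N then hadamard R else 1%:M.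
apply: cube_mxP => w u; rewrite cube_mulmx.
(* With points viewed as finite functions, the sum over the cube factors into one matrix product for
   each tensor factor. *)
rewrite (reindex (fun f : {ffun 'I_k -> 'F_2} => \row_l f l)) /=; last first.
  apply: onW_bij; exists (fun v : cube k => [ffun l => v 0 l]) => f.
    by apply/ffunP => l; rewrite ffunE mxE.
  by apply/rowP => l; rewrite mxE ffunE.
transitivity (\prod_l \sum_(x : 'F_2) M l (w 0 l) x * M l x (u 0 l)).
  rewrite bigA_distr_bigA; apply: eq_bigr => f _; rewrite !H2_entry -big_split.
  by apply: eq_bigr => l _; rewrite !mxE.
have ME l : \sum_(x : 'F_2) M l (w 0 l) x * M l x (u 0 l) = (w 0 l == u 0 l)%:R.
  transitivity ((M l *m M l) (w 0 l) (u 0 l)); first by rewrite mxE.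
  by rewrite /M; case: ifP => _; rewrite ?hadamard_sqr ?mulmx1 mxE.
under eq_bigr do rewrite ME.
rewrite cube_1mx; have [->|neq] := eqVneq w u; first by rewrite big1 // => l _; rewrite eqxx.
have /existsP[l /negPf neq_l] : [exists l, w 0 l != u 0 l].
  apply: contraR neq => /existsPn h; apply/eqP/rowP => l.
  by move/negPn/eqP: (h l).
by rewrite (bigD1 l) //= neq_l mul0r.
Qed.

Lemma H2_orthogonal : orthogonal_group R _ (H2 R k).
Proof.
rewrite /orthogonal_group /= -[RHS]H2_sqr; congr (_ *m _).
apply: cube_mxP => w u; rewrite mxE !H2_entry; apply: eq_bigr => l _.
by case: ifP => _; [rewrite hadamard_sym|rewrite !mxE eq_sym].
Qed.

Let S : set 'M[R]_(2 ^ k) := [set - 1%:M] `|` range (@Xop R k) `|` range (@Yop R k).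
Let E := @extraspecial_group R k.

Lemma affine_translation (a : cube k) : affine_bijection (fun u => u + a).
Proof.
by exists 1%:M; [exact: unitmx1 | exists a => u; rewrite mulmx1].
Qed.

Lemma extraspecial_generators_unit : S `<=` [set g | g \in unitmx].
Proof.
move=> _ [[->|[a _ <-]]|[b _ <-]] /=.
- by rewrite -scaleN1r unitmxZ ?unitmx1 // unitrN1.
- exact: orthogonal_unitmx (perm_op_orthogonal (affine_translation a)).
- exact: orthogonal_unitmx (diag_op_orthogonal (dotF2 b)).
Qed.

Let E_subgroup : is_subgroup E := generated_subgroup extraspecial_generators_unit.

Let E_N1 : E (- 1%:M).
Proof. by apply: sub_gen_smallest; left; left. Qed.

Let E_X a : E (Xop R a).
Proof. by apply: sub_gen_smallest; left; right; exists a. Qed.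

Let E_Y b : E (Yop R b).
Proof. by apply: sub_gen_smallest; right; exists b. Qed.

Let E_mul g h : E g -> E h -> E (g *m h).
Proof. by have [_ _ EM _] := E_subgroup; apply: EM. Qed.

Let E_sign (c : 'F_2) g : E g -> E (signF2 R c *: g).
Proof.
case: (F2_cases c) => ->; rewrite ?signF2_0 ?signF2_1 ?scale1r // => Eg.
by rewrite scaleN1r -[g]mul1mx -mulNmx; apply: E_mul.
Qed.

(** [- 1%:M] is central, so only the commutation relations with the operators [Xop] and [Yop]
    remain. *)
Lemma clifford_criterion g h : orthogonal_group R _ g -> g *m h = 1%:M ->
    (forall g', g' = g \/ g' = h -> forall a,
      (exists2 y, E y & g' *m Xop R a = y *m g') /\
      (exists2 y, E y & g' *m Yop R a = y *m g')) ->
  clifford_group R k g.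
Proof.
move=> og gh hXY.
have hS g' : g' = g \/ g' = h -> forall x, S x -> exists2 y, E y & g' *m x = y *m g'.
  move=> hg' x [[->|[a _ <-]]|[b _ <-]]; last 2 first.
  - by case: (hXY _ hg' a).
  - by case: (hXY _ hg' b).
  by exists (- 1%:M) => //; rewrite mulmxN mulNmx mulmx1 mul1mx.
apply: (normalizer_generated extraspecial_generators_unit og gh); apply: hS.
  by left.
by right.
Qed.

Lemma signF2_dot (b w : cube k) :
  signF2 R (dotF2 b w) = \prod_l signF2 R (b 0 l * w 0 l).
Proof.
rewrite /dotF2 mxE signF2_sum; apply: eq_bigr => l _; by rewrite mxE.
Qed.

Lemma dotF2Dr (b v w : cube k) : dotF2 b (v + w) = dotF2 b v + dotF2 b w.
Proof. by rewrite /dotF2 linearD mulmxDr mxE. Qed.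

Lemma clifford_N1 : clifford_group R k (- 1%:M).
Proof.
have N1 : (- 1%:M) *m (- 1%:M) = 1%:M :> 'M[R]_(2 ^ k).
  by rewrite mulNmx mulmxN opprK mulmx1.
apply: (@clifford_criterion _ (- 1%:M)) => //.
  rewrite /orthogonal_group /= -[RHS]N1; congr (_ *m _).
  by apply/matrixP => i j; rewrite !mxE eq_sym.
move=> g' [] -> a; split; [exists (Xop R a)|exists (Yop R a)|exists (Xop R a)|exists (Yop R a)];
  by rewrite ?mulmxN ?mulNmx ?mulmx1 ?mul1mx.
Qed.

Lemma clifford_diag q : quadratic_form q -> clifford_group R k (diag_op R q).
Proof.
move=> [A qE]; apply: (clifford_criterion (diag_op_orthogonal q) (diag_op_sqr q)).
suff H a : (exists2 y, E y & diag_op R q *m Xop R a = y *m diag_op R q) /\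
    (exists2 y, E y & diag_op R q *m Yop R a = y *m diag_op R q).
  by move=> g' [] -> a; exact: H.
split; last first.
  exists (Yop R a) => //; apply: cube_mxP => w u.
  by rewrite YopE !mul_diag_op !diag_op_entry; case: eqP => [->|_]; rewrite ?mulr0 // mulrCA.
(* [dotF2 b u] is the polar form of [q] at [(a, u)], that is [q (u + a) - q u - q a]. *)
pose b := a *m (A + A^T).
exists (signF2 R (q a) *: (Xop R a *m Yop R b)).
  by apply: E_sign; apply: E_mul.
apply: cube_mxP => w u; rewrite -scalemxAl -mulmxA [RHS]mxE mul_Xop.
rewrite XopE YopE !mul_diag_op perm_op_entry diag_op_entry subr_eq.
case: eqP => [->|_]; last by rewrite !mulr0.
rewrite !mulr1 addrK -!signF2D; congr (signF2 R _).
rewrite !qE /dotF2 /b linearD /= !mulmxDl !mulmxDr !mulmxDl.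
have tr11 (M : 'M['F_2]_1) : M^T = M by apply/matrixP => i j; rewrite mxE !ord1.
have -> : (a *m A^T *m u^T) = (u *m A *m a^T).
  by rewrite -[RHS]tr11 !trmx_mul trmxK mulmxA.
rewrite ![(_ + _ : 'M_1) 0 0]mxE addrA [RHS]addrC; congr (_ + _).
by rewrite addrC [X in _ + X]addrC addrA.
Qed.

Lemma clifford_perm phi :
  affine_bijection phi -> clifford_group R k (perm_op R phi).
Proof.
move=> aff; have [psi [aff' K K']] := affine_bijection_inv aff.
apply: (clifford_criterion (perm_op_orthogonal aff) (perm_op_mul K)).
suff H f : affine_bijection f -> forall a,
    (exists2 y, E y & perm_op R f *m Xop R a = y *m perm_op R f) /\
    (exists2 y, E y & perm_op R f *m Yop R a = y *m perm_op R f).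
  by move=> g' [] -> a; exact: H.
move=> [A Au [c fE]] a; split.
  exists (Xop R (a *m A)) => //; apply: cube_mxP => w u.
  by rewrite !XopE !mulmx_perm_op !perm_op_entry !fE mulmxDl addrAC.
(* The inverse transpose gives [dotF2 b (u *m A) = dotF2 a u]; the translation part contributes the
   sign. *)
pose b := a *m (invmx A)^T.
exists (signF2 R (dotF2 b c) *: Yop R b); first exact: E_sign.
apply: cube_mxP => w u; rewrite -scalemxAl !YopE mulmx_diag_op [RHS]mxE mul_diag_op perm_op_entry.
case: eqP => [->|_]; last by rewrite mul0r !mulr0.
rewrite mul1r mulr1 -signF2D fE dotF2Dr addrCA F2_addrr addr0; congr (signF2 R _).
by rewrite /dotF2 /b trmx_mul mulmxA -(mulmxA a) -trmx_mul mulmxV // trmx1 mulmx1.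
Qed.

Lemma clifford_H2 : clifford_group R k (H2 R k).
Proof.
apply: (clifford_criterion H2_orthogonal H2_sqr).
(* The Hadamard matrix exchanges the X and Y types in the first two factors ([lo]), and the identity
   keeps them in the others ([hi]). *)
pose lo (a : cube k) : cube k := \row_l (if (l < 2)%N then a 0 l else 0).
pose hi (a : cube k) : cube k := \row_l (if (l < 2)%N then 0 else a 0 l).
suff H a : (exists2 y, E y & H2 R k *m Xop R a = y *m H2 R k) /\
    (exists2 y, E y & H2 R k *m Yop R a = y *m H2 R k).
  by move=> g' [] -> a; exact: H.
split.
  exists (Yop R (lo a) *m Xop R (hi a)); first exact: E_mul.
  apply: cube_mxP => w u; rewrite -mulmxA YopE mul_diag_op mul_Xop XopE mulmx_perm_op.
  rewrite !H2_entry signF2_dot -big_split /=; apply: eq_bigr => l _; rewrite !mxE.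
  case: ifP => _.
    rewrite subr0 !hadamardE mulrDr signF2D [RHS]mulrC -mulrA.
    by rewrite [a 0 l * _]mulrC.
  by rewrite !mxE mul0r signF2_0 mul1r subr_eq.
exists (Yop R (hi a) *m Xop R (lo a)); first exact: E_mul.
apply: cube_mxP => w u; rewrite -mulmxA !YopE mul_diag_op mul_Xop mulmx_diag_op.
rewrite !H2_entry !signF2_dot -!big_split /=; apply: eq_bigr => l _; rewrite !mxE.
case: ifP => _.
  rewrite mul0r signF2_0 mul1r !hadamardE -mulrA -signF2D mulrBl.
  by congr (_ * signF2 R (_ + _)); apply/eqP; rewrite -addr_eq0 F2_addrr.
by rewrite !mxE subr0; case: eqP => [->|_]; rewrite ?mul1r ?mulr1 // mul0r mulr0.
Qed.

Lemma G_group_sub_clifford : G_group R k `<=` clifford_group R k.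
Proof.
apply: smallest_sub; first exact: normalizer_subgroup.
move=> _ [[[->|[q hq <-]]|[phi hphi <-]]|->].
- exact: clifford_N1.
- exact: clifford_diag.
- exact: clifford_perm.
- exact: clifford_H2.
Qed.

Lemma clifford_sub_orthogonal :
  clifford_group R k `<=` orthogonal_group R (2 ^ k).
Proof. by move=> g []. Qed.

End CliffordGenerators.

(** * The component of an invariant tensor spanned by pairing tensors *)

Section InvariantsOfG.
Local Open Scope classical_set_scope.
Local Open Scope ring_scope.
Variables (R : realType) (k d : nat).

Lemma invariant_tensors_sub (G H : set 'M[R]_(2 ^ k)) :
  G `<=` H -> invariant_tensors d H `<=` invariant_tensors d G.
Proof. by move=> GH t tH g /GH; exact: tH. Qed.

Lemma tensor_act0 (g : 'M[R]_(2 ^ k)) : tensor_act g 0 = 0 :> tensor R (2 ^ k) d.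
Proof. by apply/ffunP => j; rewrite !ffunE big1 // => i _; rewrite ffunE mulr0. Qed.

Lemma invariant_tensorsD (G : set 'M[R]_(2 ^ k)) a (s t : tensor R (2 ^ k) d) :
  invariant_tensors d G s -> invariant_tensors d G t ->
  invariant_tensors d G (a *: s + t).
Proof. by move=> Gs Gt g Gg; rewrite tensor_act_linear Gs // Gt. Qed.

(** Under the bounds on [k] and [d] assumed below, a [G_group]-invariant [t] has the same coordinate
    at all such [u] when [p] is a pairing. *)
Definition pairing_coef (t : tensor R (2 ^ k) d) (p : {ffun 'I_d -> 'I_d}) : R :=
  if [pick u : {ffun 'I_d -> cube k} | pair_type u & [forall l, u (p l) == u l]]
    is Some u then cube_coord t u else 0.

Definition pairing_part (t : tensor R (2 ^ k) d) : tensor R (2 ^ k) d :=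
  \sum_(p | pairing p) pairing_coef t p *: pairing_tensor R (2 ^ k) p.

Lemma pairing_part_orthogonal t : (0 < d)%N ->
  invariant_tensors d (orthogonal_group R (2 ^ k)) (pairing_part t).
Proof.
move=> d0; apply: (big_ind (invariant_tensors d (orthogonal_group R (2 ^ k)))).
- by move=> g _; exact: tensor_act0.
- by move=> x y hx hy; rewrite -[x]scale1r; exact: invariant_tensorsD.
move=> p pp; rewrite -[_ *: _]addr0; apply: invariant_tensorsD => [g og|g _].
  by apply: pairing_tensor_orthogonal => //; exact: mulmx1C.
exact: tensor_act0.
Qed.

Hypotheses (k_ge2 : (2 <= k)%N) (d_le6 : (d <= 6)%N).

Lemma pairing_part_pair_type t u :
    invariant_tensors d (G_group R k) t -> pair_type u ->
  cube_coord (pairing_part t) u = cube_coord t u.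
Proof.
move=> t_inv pu; have [p pp kerE] := pair_type_pairing pu.
rewrite /cube_coord sum_ffunE (bigD1 p) //= big1 ?addr0; last first.
  (* A pairing [p'] along which [u] is constant sends [l] to the only other element of its fibre, so
     it equals [p]. *)
  move=> p' /andP[pp' neq]; rewrite !ffunE; case: forallP => [h|_]; last exact: scaler0.
  case/eqP: neq; apply/ffunP => l; have := h l; rewrite !ffunE.
  rewrite (inj_eq (can_inj (@cube_indexK k))) kerE => /orP[] /eqP // pl.
  by have [_ /(_ l)] := pairingP _ pp'; rewrite pl eqxx.
have up : [forall l, u (p l) == u l] by apply/forallP => l; rewrite kerE eqxx orbT.
rewrite !ffunE; have -> : [forall l,
    [ffun l => cube_index (u l)] (p l) == [ffun l => cube_index (u l)] l].
  by apply/forallP => l; rewrite !ffunE (eqP (forallP up l)).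
rewrite [_ *: _]mulr1 /pairing_coef; case: pickP => [v /andP[pv /forallP vp]|/(_ u)]; last first.
  by rewrite pu up.
apply: (invariant_same_kernel t_inv k_ge2 (card_pair_type d_le6 pv)).
have [p' pp' kerE'] := pair_type_pairing pv.
suff pE : p' = p by move=> l m; rewrite kerE' kerE pE.
apply/ffunP => l; have := vp l; rewrite kerE' => /orP[] /eqP // pl.
by have [_ /(_ l)] := pairingP _ pp; rewrite pl eqxx.
Qed.

End InvariantsOfG.

(** * Equality of the three spaces of invariants *)

Section Comparison.
Local Open Scope classical_set_scope.
Local Open Scope ring_scope.

Lemma invariant_G_sub_orthogonal (R : realType) (k d : nat) :
    (3 <= k)%N -> (0 < d)%N -> (d <= 6)%N ->
  invariant_tensors d (G_group R k)
    `<=` invariant_tensors d (orthogonal_group R (2 ^ k)).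
Proof.
move=> k3 d0 d6 t tG; have sO := @pairing_part_orthogonal R k d t d0.
have GO : G_group R k `<=` orthogonal_group R (2 ^ k).
  exact: subset_trans (@G_group_sub_clifford R k) (@clifford_sub_orthogonal R k).
(* The difference is still invariant under [G_group], a subgroup of the orthogonal group, and
   vanishes at all pair types. *)
suff : - 1 *: pairing_part t + t = 0.
  by move/eqP; rewrite scaleN1r addrC subr_eq0 => /eqP ->.
apply: (invariant_eq0 k3 d6) => [|u pu].
  by apply: invariant_tensorsD => //; exact: invariant_tensors_sub GO _ sO.
have := pairing_part_pair_type (ltnW k3) d6 tG pu.
by rewrite /cube_coord scaleN1r !ffunE => ->; rewrite addNr.
Qed.

End Comparison.

Theorem theorem5 (R : realType) (k d : nat) (hk : (3 <= k)%N)
    (hd0 : (0 < d)%N) (hd6 : (d <= 6)%N) :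
  invariant_tensors d (G_group R k)
    = invariant_tensors d (clifford_group R k) /\
  invariant_tensors d (clifford_group R k)
    = invariant_tensors d (orthogonal_group R (2 ^ k)).
Proof.
(* Invariants shrink as the group grows; [GO] closes the cycle of inclusions. *)
have GO := @invariant_G_sub_orthogonal R k d hk hd0 hd6.
have OC := @invariant_tensors_sub R k d _ _ (@clifford_sub_orthogonal R k).
have CG := @invariant_tensors_sub R k d _ _ (@G_group_sub_clifford R k).
split; apply/seteqP; split=> t ht.
- exact/OC/GO.
- exact: CG.
- exact/GO/CG.
- exact: OC.
Qed.
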